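(* Let $d,m\ge 1$, let $\{f_i\}_{i=1}^m$ be an iterated function system of contractive similitudes on $\mathbb{R}^d$ with contraction ratios $r_1,\dots,r_m$ and self-similar set $K$, and let $M\subseteq\mathbb{R}^d$ be a nonempty compact set with $f_i(M)\subseteq M$ for all $1\le i\le m$. Let $\Pi$ be the projection map, let $U$ be the univoque set of $K$, and let $\Gamma$ and $V$ be the set of words and the set of sequences determined by $\{f_i\}_{i=1}^m$ and $M$ as defined in the context. Let $s$ be the real number determined by $$\sum_{\mathbf{i}\in\Gamma}r_{\mathbf{i}}^{\,s}=1.$$ Then $\dim_H U\ge s$, and equality $\dim_H U=s$ holds if and only if $\dim_H\Pi\left(V\cap\Pi^{-1}(U)\right)\le s$.
   Context: IFS and self-similar set. $\Omega=\{1,\dots,m\}$ and $f_i(x)=r_iR_ix+b_i$ for $i\in\Omega$, where $0<r_i<1$, $R_i$ is an orthogonal transformation of $\mathbb{R}^d$ and $b_i\in\mathbb{R}^d$. The self-similar set $K$ is the unique nonempty compact set with $K=\bigcup_{i=1}^m f_i(K)$. (Any nonempty compact $M$ with $f_i(M)\subseteq M$ for all $i$ satisfies $K\subseteq M$.) Words. $\Omega^*=\bigcup_{n\ge1}\Omega^n$ is the set of finite nonempty words over $\Omega$. For $\mathbf{i}=i_1\cdots i_k\in\Omega^*$ put $f_{\mathbf{i}}=f_{i_1}\circ\cdots\circ f_{i_k}$ and $r_{\mathbf{i}}=\prod_{\ell=1}^k r_{i_\ell}$. For $\mathbf{i}=(i_n)_{n\ge1}\in\Omega^{\mathbb{N}}$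 put $\mathbf{i}|k=i_1\cdots i_k$. If $\mathcal{T}$ is a set of words of length $n$, then $\mathcal{T}\times\Omega$ is identified with the set of words of length $n+1$ obtained by appending a letter of $\Omega$ to a word of $\mathcal{T}$. Codings and univoque set. The surjective projection $\Pi:\Omega^{\mathbb{N}}\to K$ is $\Pi((i_n)_{n\ge1})=\lim_{n\to\infty}f_{i_1}\circ\cdots\circ f_{i_n}(0)$. A sequence $\mathbf{i}\in\Omega^{\mathbb{N}}$ with $\Pi(\mathbf{i})=x$ is called a coding of $x$. The univoque set $U$ is the set of $x\in K$ having exactly one coding. The sets $\Gamma$ and $V$. Given $M$, define $$\mathcal{S}_1=\{\mathbf{k}\in\Omega: f_{\mathbf{k}}(M)\cap f_{\mathbf{j}}(M)=\emptyset\ \text{for all}\ \mathbf{j}\in\Omega\setminus\{\mathbf{k}\}\},\qquad \mathcal{T}_1=\Omega\setminus\mathcal{S}_1,$$ and for $i\ge1$ $$\mathcal{S}_{i+1}=\{\mathbf{k}\in\mathcal{T}_i\times\Omega: f_{\mathbf{k}}(M)\cap f_{\mathbf{j}}(M)=\emptyset\ \text{for all}\ \mathbf{j}\in(\mathcal{T}_i\times\Omega)\setminus\{\mathbf{k}\}\},\qquad \mathcal{T}_{i+1}=(\mathcal{T}_i\times\Omega)\setminus\mathcal{S}_{i+1}.$$ Some $\mathcal{S}_i$ may be empty. Put $\Gamma=\bigcup_{i\ge1}\mathcal{S}_i\subseteq\Omega^*$. A sequence $\mathbf{i}\in\Omega^{\mathbb{N}}$ begins with $\Gamma$ if $\mathbf{i}|k\in\Gamma$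 for some $k\in\mathbb{N}$, $k\geq 1$. Put $V=\{\mathbf{i}\in\Omega^{\mathbb{N}}:\mathbf{i}\text{ does not begin with }\Gamma\}$. $\dim_H$ is Hausdorff dimension, with $\dim_H\emptyset=0$. *)

(* Defs.v *)
From mathcomp Require Import all_boot all_order all_algebra.
From mathcomp Require Import all_classical all_reals all_analysis.
Set Implicit Arguments.
Unset Strict Implicit.
Unset Printing Implicit Defensive.
Import Order.TTheory GRing.Theory Num.Theory.
Import numFieldNormedType.Exports.
Local Open Scope classical_set_scope.
Local Open Scope ring_scope.

Section hausdorff_dimension.
Variables (R : realType) (d : nat).
Implicit Types (A : set 'cV[R]_d) (t : R).

(* The library norm on matrices is the sup norm; similitudes and Hausdorff
   dimension are taken with respect to the Euclidean one. *)
Definition enorm (x : 'cV[R]_d) : R := Num.sqrt (\sum_(i < d) x i ord0 ^+ 2).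

(* equals -oo on the empty set *)
Definition diam A : \bar R :=
  ereal_sup [set e | exists x y, [/\ A x, A y & e = (enorm (x - y))%:E]].

(* diam(A)^t, with the conventions diam(set0)^t = 0 for every t >= 0 and
   0^0 = 1, so that the 0-dimensional Hausdorff measure is the counting one *)
Definition diam_pow t A : \bar R :=
  if `[< A = set0 >] then 0%E else poweR (diam A) t.

Definition delta_cover (delta : R) A (C : nat -> set 'cV[R]_d) : Prop :=
  A `<=` \bigcup_n C n /\ forall n, (diam (C n) <= delta%:E)%E.

Definition hausdorff_premeasure t (delta : R) A : \bar R :=
  ereal_inf [set e | exists2 C, delta_cover delta A C &
                       e = (\sum_(0 <= n <oo) diam_pow t (C n))%E].

(* The supremum over delta > 0 is the limit as delta decreases to 0. *)
Definition hausdorff_measure t A : \bar R :=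
  ereal_sup [set hausdorff_premeasure t delta A | delta in [set delta | 0 < delta]].

Definition hausdorff_dim A : \bar R :=
  ereal_inf [set t%:E | t in [set t | 0 <= t /\ hausdorff_measure t A = 0%E]].

End hausdorff_dimension.

Section iterated_function_system.
Variables (R : realType) (d m : nat).

Definition orthogonal_mx (Q : 'M[R]_d) : Prop := Q^T *m Q = 1%:M.

Definition similitude (r : R) (Q : 'M[R]_d) (b x : 'cV[R]_d) : 'cV[R]_d :=
  r *: (Q *m x) + b.

Variable f : 'I_m -> 'cV[R]_d -> 'cV[R]_d.

Definition self_similar_set (K : set 'cV[R]_d) : Prop :=
  [/\ K !=set0, compact K & K = \bigcup_(i in [set: 'I_m]) (f i @` K)].

Definition word_map (w : seq 'I_m) : 'cV[R]_d -> 'cV[R]_d :=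
  foldr (fun i g => f i \o g) id w.

Definition word_ratio (r : 'I_m -> R) (w : seq 'I_m) : R := \prod_(i <- w) r i.

(* Sequences are indexed from 0: the letter i_n of the text is [u n.-1]. *)
Definition prefix_word (u : nat -> 'I_m) (k : nat) : seq 'I_m := mkseq u k.

Definition coding_map (u : nat -> 'I_m) : 'cV[R]_d :=
  lim (word_map (prefix_word u n) 0 @[n --> \oo]).

Definition univoque_set (K : set 'cV[R]_d) : set 'cV[R]_d :=
  [set x | K x /\ exists! u, coding_map u = x].

Variable M : set 'cV[R]_d.

Definition letters : set (seq 'I_m) := [set [:: i] | i in [set: 'I_m]].

Definition append_letter (T : set (seq 'I_m)) : set (seq 'I_m) :=
  [set w | exists2 v, T v & exists i, w = rcons v i].

Definition isolated (W : set (seq 'I_m)) : set (seq 'I_m) :=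
  [set k | W k /\ forall j, W j -> j <> k ->
     (word_map k @` M) `&` (word_map j @` M) = set0].

(* [S_words n] and [T_words n] are the sets S_{n+1} and T_{n+1} of the text. *)
Fixpoint T_words (n : nat) : set (seq 'I_m) :=
  if n is n'.+1
  then append_letter (T_words n') `\` isolated (append_letter (T_words n'))
  else letters `\` isolated letters.

Definition S_words (n : nat) : set (seq 'I_m) :=
  if n is n'.+1 then isolated (append_letter (T_words n')) else isolated letters.

Definition Gamma : set (seq 'I_m) := \bigcup_n S_words n.

Definition begins_with_Gamma (u : nat -> 'I_m) : Prop :=
  exists2 k, (1 <= k)%N & Gamma (prefix_word u k).

Definition V_set : set (nat -> 'I_m) := [set u | ~ begins_with_Gamma u].

End iterated_function_system.

(* Main.v *)
Require Import Defs.
From mathcomp Require Import all_boot all_order all_algebra.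
From mathcomp Require Import all_classical all_reals all_analysis.
From mathcomp Require Import lra.
Import Order.TTheory GRing.Theory Num.Theory.
Import numFieldNormedType.Exports.
Local Open Scope classical_set_scope.
Local Open Scope ring_scope.

(** The images of M under the words of Gamma are pairwise disjoint, so a coding of
    a point of f_w(M), with w in Gamma, must begin with w. Hence every infinite
    concatenation of words of Gamma codes a univoque point. For t < s, a finite
    subfamily F of Gamma already satisfies sum_F r_w^t > 1; its images of M lie at
    positive mutual distance, so a set meeting the limit set of F is contained in a
    cylinder of comparable size, and a mass distribution argument bounds the
    t-dimensional measure of U from below. Conversely, a univoque point is, up to
    countably many similitudes, either in the image of V or in a set X covered by
    the copies f_w(X), w in Gamma. For t > s the latter has measure zero because
    sum_Gamma r_w^t < 1, and only the image of V can raise the dimension above s. *)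

Set Implicit Arguments.
Unset Strict Implicit.
Unset Printing Implicit Defensive.

Lemma geometric_small (R : realType) (C rho e : R) :
  0 <= rho -> rho < 1 -> 0 < e ->
  exists N, forall n, (N <= n)%N -> C * rho ^+ n < e.
Proof.
move=> rho0 rho1 e0.
have : C * rho ^+ n @[n --> \oo] --> 0.
  rewrite -(mulr0 C); apply: cvgM; first exact: cvg_cst.
  by apply: cvg_expr; rewrite ger0_norm.
move=> /(cvgr_lt 0) /(_ _ e0) [N _ hN].
by exists N => n; exact: hN.
Qed.

(** * Avoiding cylinders *)

(* Greedy choice: a word [u] is kept as long as the words [v n] extending it have
   total weight smaller than the weight of [u], and then some letter can be
   appended to [u]. *)
Lemma exists_avoiding_sequence (R : realType) (A : finType) (p : A -> R)
    (v : nat -> seq A) :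
  (forall a, 0 <= p a) -> \sum_a p a = 1 ->
  (\sum_(0 <= n <oo) (\prod_(a <- v n) p a)%:E < 1%:E)%E ->
  exists sigma : nat -> A, forall n, mkseq sigma (size (v n)) <> v n.
Proof.
move=> p0 p1; pose P w := \prod_(a <- w) p a.
have P0 w : 0 <= P w by apply: prodr_ge0.
pose extending u n := if prefix u (v n) then P (v n) else 0.
have e0 u n : (0%:E <= (extending u n)%:E)%E.
  by rewrite lee_fin /extending; case: ifP.
pose good u := (\sum_(0 <= n <oo) (extending u n)%:E < (P u)%:E)%E.
move=> good0; have {}good0 : good [::].
  rewrite /good /P big_nil; apply: le_lt_trans good0.
  by apply: lee_nneseries => [n _ _|n _]; [exact: e0|rewrite /extending prefix0s].
have step u : good u -> exists a, good (rcons u a).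
  move=> gu; apply: contrapT => /forallNP ng; move: gu; apply/negP; rewrite -leNgt.
  (* If no letter keeps [u] good, the sums for the words [rcons u a] add up to at least [P u], since
     [p] sums to 1. A [v n] properly extending [u] extends exactly one [rcons u a], so they also add
     up to at most the sum for [u]. *)
  apply: (@le_trans _ _ (\sum_a \sum_(0 <= n <oo) (extending (rcons u a) n)%:E)%E).
    apply: (@le_trans _ _ (\sum_a (P (rcons u a))%:E)%E).
      rewrite sumEFin lee_fin -[leLHS]mulr1 -p1 mulr_sumr.
      by apply: ler_sum => a _; rewrite /P -cats1 big_cat big_seq1.
    by apply: lee_sum => a _; rewrite leNgt; apply/negP; exact: ng.
  rewrite -nneseries_sum => [|a n _]; last exact: e0.
  apply: lee_nneseries => [n _ _|n _]; first by apply: sume_ge0 => a _; exact: e0.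
  rewrite sumEFin lee_fin /extending.
  case: (boolP (prefix u (v n))) => [/prefixP[[|b z] ->]|npu].
  - rewrite big1// => a _; case: ifP => // /size_prefix.
    by rewrite size_rcons cats0 ltnn.
  - rewrite -big_mkcond (big_pred1 b)// => a.
    by rewrite -cats1 prefix_catr// eqxx prefix_cons prefix0s andbT.
  - rewrite big1// => a _; case: ifP => // pua.
    by move: npu; rewrite (prefix_trans (prefix_rcons _ _) pua).
have [a0 _] := step _ good0.
have /choice[g gP] u : exists a, good u -> good (rcons u a).
  have [/step[a ga]|ngu] := pselect (good u); first by exists a.
  by exists a0.
pose w := fix w n := if n is n'.+1 then rcons (w n') (g (w n')) else [::].
have good_w n : good (w n) by elim: n => //= n; exact: gP.
have mkseq_w n : mkseq (g \o w) n = w n by elim: n => //= n IH; rewrite mkseqS IH.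
(* A prefix equal to [v n] would have [P (v n)] as a term of its own sum, which goodness keeps
   strictly below [P (v n)]. *)
exists (g \o w) => n vn; have := good_w (size (v n)).
rewrite -mkseq_w vn; apply/negP; rewrite -leNgt.
rewrite nneseries_esumT => [|k]; last exact: e0.
have {1}-> : P (v n) = extending (v n) n by rewrite /extending prefix_refl.
by apply: esum_ge; exists [set n]; [split|rewrite fsbig_set1].
Qed.

(** * The Euclidean norm *)

Section euclidean_norm.
Context {R : realType} {d : nat}.
Implicit Types (x y : 'cV[R]_d).

Lemma enorm_ge0 x : 0 <= enorm x.
Proof. exact: sqrtr_ge0. Qed.

Lemma sqr_enorm x : enorm x ^+ 2 = \sum_(i < d) x i ord0 ^+ 2.
Proof. by rewrite sqr_sqrtr// sumr_ge0// => i _; exact: sqr_ge0. Qed.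

(** Compactness and limits refer to the sup norm, diameters to the Euclidean one; this bound and
    [enorm_le_norm] pass between them. *)
Lemma norm_le_enorm x : `|x| <= enorm x.
Proof.
rewrite [leLHS]mx_normrE; apply: bigmax_le; first exact: enorm_ge0.
move=> [i j] _ /=; rewrite ord1 -(@ler_pXn2r _ 2) ?nnegrE ?enorm_ge0//.
rewrite sqr_enorm real_normK ?num_real// (bigD1 i)//= lerDl.
by apply: sumr_ge0 => k _; exact: sqr_ge0.
Qed.

Lemma enorm_le_norm x : enorm x <= Num.sqrt d%:R * `|x|.
Proof.
rewrite -(@ler_pXn2r _ 2) ?nnegrE ?enorm_ge0 ?mulr_ge0 ?sqrtr_ge0//.
have -> : (Num.sqrt d%:R * `|x|) ^+ 2 = \sum_(i < d) `|x| ^+ 2.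
  by rewrite exprMn sqr_sqrtr// sumr_const card_ord mulr_natl.
rewrite sqr_enorm; apply: ler_sum => i _.
rewrite -real_normK ?num_real// lerXn2r ?nnegrE//.
rewrite [`|x|]mx_normrE.
by apply/bigmax_geP; right => /=; exists (i, ord0).
Qed.

Lemma enorm_eq0 x : (enorm x == 0) = (x == 0).
Proof.
apply/eqP/eqP => [x0|->]; apply/eqP; last first.
  by rewrite eq_le enorm_ge0 (le_trans (enorm_le_norm 0))// normr0 mulr0.
by rewrite -normr_eq0 eq_le normr_ge0 andbT -x0 norm_le_enorm.
Qed.

Lemma enormZ (a : R) x : enorm (a *: x) = `|a| * enorm x.
Proof.
rewrite /enorm -sqrtr_sqr -sqrtrM ?sqr_ge0// mulr_sumr; congr Num.sqrt.
by apply: eq_bigr => i _; rewrite mxE exprMn.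
Qed.

Lemma enorm_orthogonal_mx (Q : 'M[R]_d) x : orthogonal_mx Q ->
  enorm (Q *m x) = enorm x.
Proof.
move=> hQ; have E z : enorm z = Num.sqrt ((z^T *m z) ord0 ord0).
  by rewrite mxE; congr Num.sqrt; apply: eq_bigr => i _; rewrite mxE expr2.
by rewrite !E trmx_mul mulmxA -(mulmxA _ Q^T) hQ mulmx1.
Qed.

Lemma enorm_similitude (r : R) (Q : 'M[R]_d) (b x y : 'cV[R]_d) :
  0 <= r -> orthogonal_mx Q ->
  enorm (similitude r Q b x - similitude r Q b y) = r * enorm (x - y).
Proof.
move=> r0 hQ; rewrite /similitude opprD addrACA subrr addr0 -scalerBr -mulmxBr.
by rewrite enormZ ger0_norm// enorm_orthogonal_mx.
Qed.

Lemma continuous_similarity (c : R) (g : 'cV[R]_d -> 'cV[R]_d) :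
  (forall x y, enorm (g x - g y) = c * enorm (x - y)) -> continuous g.
Proof.
move=> gE x; apply/(@cvgrPdist_lt _ _ _ (nbhs x)) => e e0.
pose k := `|c| * Num.sqrt d%:R + 1.
have k0 : 0 < k by rewrite ltr_wpDl// mulr_ge0// sqrtr_ge0.
near=> y; rewrite (le_lt_trans (norm_le_enorm _))// gE.
apply: (@le_lt_trans _ _ (k * `|x - y|)).
  apply: (@le_trans _ _ (`|c| * (Num.sqrt d%:R * `|x - y|))).
    rewrite (le_trans (ler_wpM2r (enorm_ge0 _) (ler_norm c)))//.
    by rewrite ler_wpM2l// enorm_le_norm.
  by rewrite mulrA ler_wpM2r// lerDl.
rewrite mulrC -ltr_pdivlMr//; near: y.
apply/nbhs_ballP; exists (e / k) => /=; first by rewrite divr_gt0.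
by move=> y; rewrite -ball_normE.
Unshelve. all: by end_near. Qed.

Lemma compact_enorm_bounded (A : set 'cV[R]_d) : compact A ->
  exists2 B : R, 0 < B & forall x y, A x -> A y -> enorm (x - y) <= B.
Proof.
move=> /compact_bounded[B [_ hB]].
have {}hB x : A x -> `|x| <= `|B| + 1.
  by apply: hB; rewrite (le_lt_trans (ler_norm B))// ltrDl.
exists (Num.sqrt d%:R * (`|B| + 1 + (`|B| + 1)) + 1).
  by rewrite ltr_wpDl// mulr_ge0 ?sqrtr_ge0// ?addr_ge0.
move=> x y Ax Ay; rewrite (le_trans (enorm_le_norm _))// ler_wpDr//.
by rewrite ler_wpM2l ?sqrtr_ge0// (le_trans (ler_normB _ _))// lerD// hB.
Qed.

(** The set of differences x - y is compact, hence closed, and misses 0, so a ball around 0 avoids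
    it. *)
Lemma disjoint_compact_gap (A B : set 'cV[R]_d) :
  compact A -> compact B -> A `&` B = set0 ->
  exists2 c : R, 0 < c & forall x y, A x -> B y -> c <= enorm (x - y).
Proof.
move=> cA cB AB0; pose D := (fun z : 'cV[R]_d * 'cV[R]_d => z.1 - z.2) @` (A `*` B).
have cD : compact D.
  apply: continuous_compact; last exact: compact_setX.
  apply: continuous_subspaceT => z; apply: cvgB; first exact: cvg_fst.
  exact: cvg_snd.
have D0 : ~ D 0.
  move=> [[x y]] /= [Ax By] /eqP; rewrite subr_eq0 => /eqP xy.
  suff : (A `&` B) x by rewrite AB0.
  by split => //; rewrite xy.
have : nbhs (0 : 'cV[R]_d) (~` D).
  apply: open_nbhs_nbhs; split => //; rewrite openC.
  by apply: compact_closed => //; exact: norm_hausdorff.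
move=> /nbhs_ballP[e /= e0 eD]; exists e => // x y Ax By.
rewrite leNgt; apply/negP => xye.
have : (~` D) (x - y).
  by apply: eD; rewrite -ball_normE /= sub0r normrN (le_lt_trans (norm_le_enorm _)).
by apply; exists (x, y).
Qed.

End euclidean_norm.

(** * Hausdorff measure *)

Section countable_sums.
Local Open Scope ereal_scope.
Context {R : realType}.

(** Numbers coding no element contribute 0. This turns the series in the definition of the
    premeasure into sums over words or pairs. *)
Lemma nneseries_pickle_inv (T : countType) (a : T -> \bar R) :
  (forall i, 0 <= a i) ->
  \sum_(0 <= n <oo) (if @pickle_inv T n is Some i then a i else 0) =
  \esum_(i in [set: T]) a i.
Proof.
move=> a0; pose b n := if @pickle_inv T n is Some i then a i else 0.
have b0 n : 0 <= b n by rewrite /b; case: pickle_inv.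
rewrite (nneseries_esumT b0).
rewrite (_ : \esum_(n in [set: nat]) b n =
    \esum_(n in range (@pickle T)) b n); last first.
  rewrite [RHS]esum_mkcond; apply: eq_esum => n _; case: ifPn => //.
  rewrite notin_setE /b => nT; have := @pickle_invK T n.
  by case: pickle_inv => //= i iE; exfalso; apply: nT; exists i.
rewrite esum_image; first by apply: eq_esum => i _; rewrite /b pickleK_inv.
by move=> i j _ _; apply: (pcan_inj pickleK_inv).
Qed.

Lemma esum_pickle_geometric (T : countType) (e : R) : (0 <= e)%R ->
  \esum_(i in [set: T]) (e / (2 ^ (pickle i).+1)%:R)%:E <= e%:E.
Proof.
move=> e0; rewrite -nneseries_pickle_inv => [|i]; last first.
  by rewrite lee_fin divr_ge0.
apply: le_trans (epsilon_trick0 xpredT e0); apply: lee_nneseries => [n _ _|n _] /=.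
  by case: pickle_inv => // i; rewrite lee_fin divr_ge0.
have := @pickle_invK T n; case: pickle_inv => [i /= <-//|_].
by rewrite lee_fin divr_ge0.
Qed.

Lemma esumZl_le (T : choiceType) (c : \bar R) (I : set T) (a : T -> \bar R) :
  0 <= c -> (forall i, 0 <= a i) ->
  \esum_(i in I) (c * a i) <= c * \esum_(i in I) a i.
Proof.
move=> c0 a0; apply: ge_ereal_sup => _ [X [finX XI] <-].
rewrite -ge0_mule_fsumr//; apply: lee_wpmul2l => //.
by apply: ereal_sup_ubound; exists X.
Qed.

Lemma esum_ge_term (T : choiceType) (I : set T) (a : T -> \bar R) i :
  I i -> 0 <= a i -> a i <= \esum_(j in I) a j.
Proof.
move=> Ii ai; apply: esum_ge; exists [set i]; last by rewrite fsbig_set1.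
by split => [|_ ->]; first exact: finite_set1.
Qed.

End countable_sums.

Section hausdorff_measure_theory.
Local Open Scope ereal_scope.
Context {R : realType} {d : nat}.
Implicit Types (A B : set 'cV[R]_d) (t delta : R).
Local Notation H := (@hausdorff_premeasure R d).

Lemma diam_pow_ge0 t A : 0 <= diam_pow t A.
Proof. by rewrite /diam_pow; case: ifP => // _; exact: poweR_ge0. Qed.

Lemma diam_pow0 t : diam_pow t (set0 : set 'cV[R]_d) = 0.
Proof. by rewrite /diam_pow; case: asboolP. Qed.

Lemma diam_powE t A : A !=set0 -> diam_pow t A = poweR (diam A) t.
Proof. by rewrite /diam_pow; case: asboolP => // -> /set0P/eqP. Qed.

Lemma diam_ge A x y : A x -> A y -> (enorm (x - y))%:E <= diam A.
Proof. by move=> Ax Ay; apply: ereal_sup_ubound; exists x, y. Qed.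

Lemma diam_ge0 A : A !=set0 -> 0 <= diam A.
Proof.
by move=> [x Ax]; rewrite (le_trans _ (diam_ge Ax Ax))// lee_fin enorm_ge0.
Qed.

Lemma diam0 : diam (set0 : set 'cV[R]_d) = -oo.
Proof.
rewrite /diam -(@ereal_sup0 R); congr ereal_sup.
by apply/seteqP; split => // e [x [y []]].
Qed.

Lemma hausdorff_premeasure_ge0 t delta A : 0 <= H t delta A.
Proof.
apply: le_ereal_inf_tmp => _ [C _ ->].
by apply: nneseries_ge0 => n _ _; exact: diam_pow_ge0.
Qed.

(** The family becomes a sequence by padding with empty sets. These cost nothing, even for [t = 0]:
    their diameter is [-oo] and their [diam_pow] is 0. *)
Lemma hausdorff_premeasure_le (T : countType) t delta A (C : T -> set 'cV[R]_d) :
  A `<=` \bigcup_i C i -> (forall i, diam (C i) <= delta%:E) ->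
  H t delta A <= \esum_(i in [set: T]) diam_pow t (C i).
Proof.
move=> AC Cd; pose D n := if @pickle_inv T n is Some i then C i else set0.
apply: ge_ereal_inf; exists (\sum_(0 <= n <oo) diam_pow t (D n)).
  exists D => //; split => [x /AC[i _ Cix]|n].
    by exists (pickle i) => //; rewrite /D pickleK_inv.
  by rewrite /D; case: pickle_inv => //; rewrite diam0 leNye.
rewrite -nneseries_pickle_inv => [|i]; last exact: diam_pow_ge0.
apply: lee_nneseries => [n _ _|n _]; first exact: diam_pow_ge0.
by rewrite /D; case: pickle_inv => //; rewrite diam_pow0.
Qed.

Lemma hausdorff_premeasure_cover t delta A (C : set 'cV[R]_d) :
  A `<=` C -> diam C <= delta%:E -> H t delta A <= diam_pow t C.
Proof.
move=> AC Cd; rewrite (le_trans (@hausdorff_premeasure_le unit _ _ _ (fun=> C) _ _))//.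
  by move=> x /AC; exists tt.
rewrite (_ : [set: unit] = [set tt]) ?esum_set1 ?diam_pow_ge0//.
by apply/seteqP; split => // -[].
Qed.

Lemma hausdorff_premeasure_sub t delta A B : A `<=` B ->
  H t delta A <= H t delta B.
Proof.
move=> AB; apply: ereal_inf_le_tmp => _ [C [BC Cd] ->].
by exists C => //; split => //; exact: subset_trans BC.
Qed.

Lemma hausdorff_premeasure0 t delta : H t delta set0 = 0.
Proof.
apply/eqP; rewrite eq_le hausdorff_premeasure_ge0 andbT.
rewrite -(diam_pow0 t); apply: hausdorff_premeasure_cover => //.
by rewrite diam0 leNye.
Qed.

(** Almost optimal covers of the pieces, with errors [eps i] summing to at most [e], merge into one
    cover indexed by pairs. *)
Lemma hausdorff_premeasure_bigcupT (T : countType) t delta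
    (A : T -> set 'cV[R]_d) :
  H t delta (\bigcup_i A i) <= \esum_(i in [set: T]) H t delta (A i).
Proof.
apply/lee_addgt0Pr => e e0.
have [->|Sfin] := eqVneq (\esum_(i in [set: T]) H t delta (A i)) +oo.
  by rewrite addye// leey.
pose eps i := (e / (2 ^ (pickle (i : T)).+1)%:R)%R.
have eps0 i : (0 < eps i)%R by rewrite divr_gt0// ltr0n expn_gt0.
(* Only for a finite value is adding [eps i] a strict increase, which yields the almost optimal
   cover. *)
have Hfin i : H t delta (A i) \is a fin_num.
  rewrite ge0_fin_numE ?hausdorff_premeasure_ge0// ltey.
  apply: contra_neq Sfin => Hy; apply/eqP; rewrite -leye_eq -[leLHS]Hy.
  apply: (esum_ge_term (a := fun i => H t delta (A i))) => //.
  exact: hausdorff_premeasure_ge0.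
have /choice[C CP] i : exists C, delta_cover delta (A i) C /\
    \sum_(0 <= n <oo) diam_pow t (C n) <= H t delta (A i) + (eps i)%:E.
  have /ereal_inf_lt[_ [C Ccov ->] /ltW Clt] : H t delta (A i) <
    H t delta (A i) + (eps i)%:E by rewrite lteDl// lte_fin.
  by exists C.
apply: (@le_trans _ _ (\esum_(k in [set: T * nat]) diam_pow t (C k.1 k.2))).
  apply: hausdorff_premeasure_le => [x [i _ Aix]|[i n]].
    by have [[/(_ _ Aix)[n _ Cx] _] _] := CP i; exists (i, n).
  by have [[_ +] _] := CP i; exact.
rewrite (_ : [set: T * nat] = [set: T] `*`` (fun=> [set: nat])); last first.
  by apply/seteqP; split.
rewrite -(esum_esum (a := fun i n => diam_pow t (C i n))); last first.
  by move=> i n _ _; exact: diam_pow_ge0.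
apply: (@le_trans _ _ (\esum_(i in [set: T]) (H t delta (A i) + (eps i)%:E))).
  apply: le_esum => i _; rewrite -nneseries_esumT => [|n]; last exact: diam_pow_ge0.
  by have [_] := CP i.
rewrite esumD => [|i _|i _]; last 2 first.
  exact: hausdorff_premeasure_ge0.
  by rewrite lee_fin ltW.
by rewrite leeD2l// esum_pickle_geometric// ltW.
Qed.

Lemma hausdorff_premeasure_bigcup (T : countType) t delta (I : set T)
    (A : T -> set 'cV[R]_d) :
  H t delta (\bigcup_(i in I) A i) <= \esum_(i in I) H t delta (A i).
Proof.
rewrite bigcup_mkcond esum_mkcond.
apply: le_trans (hausdorff_premeasure_bigcupT _ _ _) _.
apply: le_esum => i _; by case: ifPn => // _; rewrite hausdorff_premeasure0.
Qed.

(** The map [g] carries a cover at scale [delta / c] to one at scale [delta]. The scale stays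
    explicit because [hausdorff_measure_eq0_self_covered] rescales it at every step. *)
Lemma hausdorff_premeasure_similarity t delta A (c : R) (g : 'cV[R]_d -> 'cV[R]_d) :
  (0 < c)%R -> (0 <= t)%R ->
  (forall x y, enorm (g x - g y) = c * enorm (x - y))%R ->
  H t delta (g @` A) <= (c `^ t)%:E * H t (delta / c) A.
Proof.
move=> c0 t0 gE; have ct0 : (0 < c `^ t)%R by exact: powR_gt0.
have diamg B : B !=set0 -> diam (g @` B) <= c%:E * diam B.
  move=> B0; apply: ge_ereal_sup => _ [_ [_ [[x Bx <-] [y By <-] ->]]].
  rewrite gE EFinM; apply: lee_wpmul2l; last exact: diam_ge.
  by rewrite lee_fin ltW.
rewrite -lee_pdivrMl//; apply: le_ereal_inf_tmp => _ [C [AC Cd] ->].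
rewrite lee_pdivrMl//.
have diam_powg B : diam_pow t (g @` B) <= (c `^ t)%:E * diam_pow t B.
  have [->|/set0P B0] := eqVneq B set0.
    by rewrite image_set0 diam_pow0 mule0.
  rewrite !diam_powE//; last exact: image_nonempty.
  rewrite -poweR_EFin -poweRM ?diam_ge0 ?lee_fin ?(ltW c0)//.
  have gB0 : 0 <= diam (g @` B) by apply: diam_ge0; exact: image_nonempty.
  have cB0 : 0 <= c%:E * diam B.
    by apply: mule_ge0; [rewrite lee_fin ltW | exact: diam_ge0].
  by apply: (gt0_ler_poweR t0 _ _ (diamg _ B0)); rewrite in_itv/= leey andbT.
apply: (@le_trans _ _ (\sum_(0 <= n <oo) diam_pow t (g @` C n))).
  apply: ge_ereal_inf; exists (\sum_(0 <= n <oo) diam_pow t (g @` C n)) => //.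
  exists (fun n => g @` C n) => //; split => [_ [x /AC[n _ Cx] <-]|n].
    by exists n => //; exists x.
  have [->|/set0P C0] := eqVneq (C n) set0.
    by rewrite image_set0 diam0 leNye.
  apply: le_trans (diamg _ C0) _; rewrite -lee_pdivlMl// muleC -EFinM.
  by apply: le_trans (Cd n) _; rewrite lee_fin.
rewrite -nneseriesZl => [|n _]; last exact: diam_pow_ge0.
by apply: lee_nneseries => [n _ _|n _]; [exact: diam_pow_ge0 | exact: diam_powg].
Qed.

Lemma hausdorff_measure_eq0 t A :
  hausdorff_measure t A = 0 <-> forall delta, (0 < delta)%R -> H t delta A = 0.
Proof.
split=> [HA delta d0|HA].
  apply/eqP; rewrite eq_le hausdorff_premeasure_ge0 andbT -HA.
  by apply: ereal_sup_ubound; exists delta.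
apply/eqP; rewrite eq_le; apply/andP; split.
  by apply: ge_ereal_sup => _ [delta d0 <-]; rewrite HA.
rewrite -(HA 1%R)//; by apply: ereal_sup_ubound; exists 1%R => /=.
Qed.

Lemma hausdorff_measure_eq0_bigcup (T : countType) t (I : set T)
    (A : T -> set 'cV[R]_d) :
  (forall i, I i -> hausdorff_measure t (A i) = 0) ->
  hausdorff_measure t (\bigcup_(i in I) A i) = 0.
Proof.
move=> HA; apply/hausdorff_measure_eq0 => delta d0; apply/eqP.
rewrite eq_le hausdorff_premeasure_ge0 andbT.
apply: le_trans (hausdorff_premeasure_bigcup _ _ _ _) _.
rewrite esum1// => i /HA/hausdorff_measure_eq0; exact.
Qed.

Lemma hausdorff_measure_eq0_sub t A B : A `<=` B ->
  hausdorff_measure t B = 0 -> hausdorff_measure t A = 0.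
Proof.
move=> AB /hausdorff_measure_eq0 HB; apply/hausdorff_measure_eq0 => delta d0.
apply/eqP; rewrite eq_le hausdorff_premeasure_ge0 andbT -(HB _ d0).
exact: hausdorff_premeasure_sub.
Qed.

Lemma hausdorff_measure_eq0_similarity t A (c : R) (g : 'cV[R]_d -> 'cV[R]_d) :
  (0 < c)%R -> (0 <= t)%R ->
  (forall x y, enorm (g x - g y) = c * enorm (x - y))%R ->
  hausdorff_measure t A = 0 -> hausdorff_measure t (g @` A) = 0.
Proof.
move=> c0 t0 gE /hausdorff_measure_eq0 HA.
apply/hausdorff_measure_eq0 => delta d0; apply/eqP.
rewrite eq_le hausdorff_premeasure_ge0 andbT.
apply: le_trans (hausdorff_premeasure_similarity _ _ c0 t0 gE) _.
by rewrite HA ?mule0// divr_gt0.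
Qed.

Lemma hausdorff_measure_eq0_lt t0 t A : (0 <= t0)%R -> (t0 < t)%R ->
  hausdorff_measure t0 A = 0 -> hausdorff_measure t A = 0.
Proof.
move=> t00 t0t /hausdorff_measure_eq0 HA.
apply/hausdorff_measure_eq0 => delta d0; apply/eqP.
rewrite eq_le hausdorff_premeasure_ge0 andbT.
(* At scale at most 1 a larger exponent gives a smaller power of the diameter. *)
have m0 : (0 < Num.min delta 1)%R by rewrite lt_min d0 ltr01.
rewrite -(HA _ m0); apply: le_ereal_inf_tmp => _ [C [AC Cd] ->].
apply: (@le_trans _ _ (\sum_(0 <= n <oo) diam_pow t (C n))).
  apply: ge_ereal_inf; exists (\sum_(0 <= n <oo) diam_pow t (C n)) => //.
  exists C => //; split => // n; apply: le_trans (Cd n) _.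
  by rewrite lee_fin ge_min lexx.
apply: lee_nneseries => [n _ _|n _]; first exact: diam_pow_ge0.
have [->|/set0P C0] := eqVneq (C n) set0; first by rewrite !diam_pow0.
rewrite !diam_powE//; have := Cd n; have := diam_ge0 C0.
case: (diam (C n)) => [a| |] //; rewrite !lee_fin le_min => a0 /andP[_ a1].
(* For diameter 0 the left side vanishes because [t > 0]; the right side may be 0 or 1. *)
have [->|an0] := eqVneq a 0%R.
  by rewrite powR0 ?powR_ge0// gt_eqF// (le_lt_trans t00).
by apply: ger_powR; [rewrite lt_neqAle eq_sym an0 a0 | exact: ltW].
Qed.

Lemma hausdorff_dim_sub A B : A `<=` B -> hausdorff_dim A <= hausdorff_dim B.
Proof.
move=> AB; apply: ereal_inf_le_tmp => _ [t [t0 HB] <-].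
by exists t => //; split => //; exact: hausdorff_measure_eq0_sub HB.
Qed.

Lemma hausdorff_dim_lt t A : hausdorff_dim A < t%:E ->
  hausdorff_measure t A = 0.
Proof.
move=> /ereal_inf_lt[_ [t0 [t00 HA] <-]]; rewrite lte_fin => t0t.
exact: hausdorff_measure_eq0_lt HA.
Qed.

Lemma hausdorff_dim_le t A : (0 <= t)%R ->
  (forall t', (t < t')%R -> hausdorff_measure t' A = 0) ->
  hausdorff_dim A <= t%:E.
Proof.
move=> t0 HA; apply/lee_addgt0Pr => e e0; apply: ereal_inf_lbound.
by exists (t + e)%R => //; split; [rewrite addr_ge0// ltW | rewrite HA// ltrDl].
Qed.

Lemma hausdorff_dim_ge s A :
  (forall t, (0 <= t)%R -> (t < s)%R -> hausdorff_measure t A <> 0) ->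
  s%:E <= hausdorff_dim A.
Proof.
move=> HA; apply: le_ereal_inf_tmp => _ [t [t0 HAt] <-].
by rewrite lee_fin leNgt; apply/negP => ts; exact: HA t0 ts HAt.
Qed.

End hausdorff_measure_theory.

(** * Codings and the words of Gamma *)

Section coding.
Context {R : realType} {d m : nat}.
Context {f : 'I_m -> 'cV[R]_d -> 'cV[R]_d} {r : 'I_m -> R}.
Hypothesis hr : forall i, 0 < r i < 1.
Hypothesis hf : forall i x y, enorm (f i x - f i y) = r i * enorm (x - y).
Implicit Types (w v : seq 'I_m) (u : nat -> 'I_m).

Lemma word_map_cat w v x :
  word_map f (w ++ v) x = word_map f w (word_map f v x).
Proof. by elim: w => //= i w ->. Qed.

Lemma word_ratio_cat w v :
  word_ratio r (w ++ v) = word_ratio r w * word_ratio r v.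
Proof. by rewrite /word_ratio big_cat. Qed.

Lemma word_ratio_gt0 w : 0 < word_ratio r w.
Proof. by apply: prodr_gt0 => i _; have /andP[] := hr i. Qed.

Lemma ratio_bound : exists2 rho : R, 0 < rho < 1 & forall i, r i <= rho.
Proof.
(* The seed [2^-1] keeps the maximum positive even over an empty alphabet. *)
exists (\big[Num.max/2^-1]_i r i); last by move=> i; exact: le_bigmax.
rewrite (@lt_le_trans _ _ 2^-1) ?invr_gt0 ?ltr0n ?bigmax_ge_id//=.
apply: bigmax_lt; first by rewrite invf_lt1 ?ltr1n ?ltr0n.
by move=> i _; have /andP[] := hr i.
Qed.

Lemma word_ratio_le (rho : R) w : (forall i, r i <= rho) ->
  word_ratio r w <= rho ^+ size w.
Proof.
move=> rrho; elim: w => [|i w IH]; first by rewrite /word_ratio big_nil.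
rewrite /word_ratio big_cons exprS ler_pM//; last exact/ltW/word_ratio_gt0.
by have /andP[/ltW] := hr i.
Qed.

Lemma enorm_word_map w x y :
  enorm (word_map f w x - word_map f w y) = word_ratio r w * enorm (x - y).
Proof.
elim: w => [|i w IH] /=; first by rewrite /word_ratio big_nil mul1r.
by rewrite hf IH /word_ratio big_cons mulrA.
Qed.

Lemma word_map_inj w : injective (word_map f w).
Proof.
move=> x y xy; apply/eqP; rewrite -subr_eq0 -enorm_eq0.
have /eqP := enorm_word_map w x y.
have -> : word_map f w x - word_map f w y = 0 by rewrite xy subrr.
have /eqP -> : enorm (0 : 'cV[R]_d) == 0 by rewrite enorm_eq0.
by rewrite eq_sym mulf_eq0 gt_eqF// word_ratio_gt0.
Qed.

Lemma continuous_word_map w : continuous (word_map f w).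
Proof. exact/continuous_similarity/enorm_word_map. Qed.

Definition shift u k : nat -> 'I_m := fun n => u (k + n)%N.

Lemma size_prefix_word u k : size (prefix_word u k) = k.
Proof. exact: size_mkseq. Qed.

Lemma prefix_wordD u k n :
  prefix_word u (k + n) = prefix_word u k ++ prefix_word (shift u k) n.
Proof.
apply: (@eq_from_nth _ (u 0%N)); first by rewrite size_cat !size_prefix_word.
rewrite size_prefix_word => i ikn.
rewrite nth_cat size_prefix_word nth_mkseq//; case: ltnP => ki.
  by rewrite nth_mkseq.
by rewrite nth_mkseq ?ltn_subLR// /shift subnKC.
Qed.

Context {M : set 'cV[R]_d}.
Hypothesis hM0 : M !=set0.
Hypothesis hMc : compact M.
Hypothesis hMf : forall i, f i @` M `<=` M.

Lemma word_map_invariant w : word_map f w @` M `<=` M.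
Proof.
elim: w => [|i w IH] /=; first by rewrite image_id.
move=> _ [x Mx <-] /=; apply: (@hMf i _); exists (word_map f w x) => //.
by apply: IH; exists x.
Qed.

Lemma word_map_image_cat w v :
  word_map f (w ++ v) @` M `<=` word_map f w @` M.
Proof.
move=> _ [x Mx <-]; rewrite word_map_cat; exists (word_map f v x) => //.
by apply: (@word_map_invariant v); exists x.
Qed.

Lemma compact_word_map w : compact (word_map f w @` M).
Proof.
apply: continuous_compact hMc.
by apply: continuous_subspaceT; exact: continuous_word_map.
Qed.

(** The points [z n] stay in the compact set [M] and so have a cluster point. Each image is closed
    and contains all later [z k], hence also that point. *)
Lemma nested_images_meet u :
  exists y, forall n, (word_map f (prefix_word u n) @` M) y.
Proof.
have [p Mp] := hM0; pose z n := word_map f (prefix_word u n) p.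
have [|y [_ yz]] := hMc (F := z n @[n --> \oo]).
  by exists 0%N => // n _; apply: (@word_map_invariant (prefix_word u n)); exists p.
exists y => n.
have : closed (word_map f (prefix_word u n) @` M).
  apply: compact_closed; last exact: compact_word_map.
  exact: norm_hausdorff.
apply => B By; apply: yz => //; exists n => // k /= nk.
have : (word_map f (prefix_word u k) @` M) (z k) by exists p.
by rewrite -(subnKC nk) prefix_wordD; exact: word_map_image_cat.
Qed.

(** Both [y] and the n-th approximant are images under the map of the n-th prefix, which contracts
    by at most [rho ^+ n]. The constant [C] bounds the distance from 0 to points of [M]; 0 need not
    lie in [M]. *)
Lemma coding_map_eq u y :
  (forall n, (word_map f (prefix_word u n) @` M) y) -> coding_map f u = y.
Proof.
move=> hy; apply: cvg_lim; first exact: norm_hausdorff.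
have [rho /andP[rho0 rho1] rrho] := ratio_bound.
have [p Mp] := hM0; have [B B0 hB] := compact_enorm_bounded hMc.
pose C := Num.sqrt d%:R * (`|p| + B).
have C0 : 0 <= C by rewrite mulr_ge0 ?sqrtr_ge0// addr_ge0// ltW.
have key n : `|y - word_map f (prefix_word u n) 0| <= C * rho ^+ n.
  have [x Mx <-] := hy n; apply: le_trans (norm_le_enorm _) _.
  rewrite enorm_word_map mulrC ler_pM ?enorm_ge0//.
  - exact/ltW/word_ratio_gt0.
  - apply: le_trans (enorm_le_norm _) _; rewrite ler_wpM2l ?sqrtr_ge0// subr0.
    rewrite -[x](subrK p) addrC (le_trans (ler_normD _ _))// lerD2l.
    by rewrite (le_trans (norm_le_enorm _)) ?hB.
  - by have := word_ratio_le (prefix_word u n) rrho; rewrite size_prefix_word.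
apply/cvgrPdist_lt => e e0.
have [N hN] := geometric_small C (ltW rho0) rho1 e0.
near=> n; apply: le_lt_trans (key n) _; apply: hN.
by near: n; exists N.
Unshelve. all: by end_near. Qed.

Lemma coding_map_mem u n :
  (word_map f (prefix_word u n) @` M) (coding_map f u).
Proof. by have [y hy] := nested_images_meet u; rewrite (coding_map_eq hy). Qed.

Lemma coding_map_shift u k :
  coding_map f u = word_map f (prefix_word u k) (coding_map f (shift u k)).
Proof.
apply: coding_map_eq => n.
have [x Mx xE] := coding_map_mem (shift u k) n; rewrite -xE.
rewrite -word_map_cat -prefix_wordD addnC prefix_wordD.
by apply: word_map_image_cat; exists x.
Qed.

(** The candidates among which stage [n] selects; this puts both cases of [S_words] and [T_words]
    under one formula. *)
Definition level n : set (seq 'I_m) :=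
  if n is n'.+1 then append_letter (T_words f M n') else @letters m.

Lemma S_wordsE n : S_words f M n = Defs.isolated f M (level n).
Proof. by case: n. Qed.

Lemma T_wordsE n : T_words f M n = level n `\` S_words f M n.
Proof. by case: n. Qed.

Lemma size_level n w : level n w -> size w = n.+1.
Proof.
elim: n w => [|n IH] w; first by move=> [i _ <-].
by move=> [v]; rewrite T_wordsE => -[/IH sv _] [i ->]; rewrite size_rcons sv.
Qed.

(** Only words left over at a stage are extended, so every shorter nonempty prefix of a candidate
    was left over. Words of stage [j] have length [j.+1]. *)
Lemma take_level j n w : (j < n)%N -> level n w -> T_words f M j (take j.+1 w).
Proof.
elim: n w => // n IH w; rewrite ltnS => jn [v Tv [i ->]].
have [lv _] : (level n `\` S_words f M n) v by rewrite -T_wordsE.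
rewrite -cats1 takel_cat ?(size_level lv)//.
move: jn; rewrite leq_eqVlt => /orP[/eqP ->|jn]; last exact: IH.
by rewrite take_oversize ?(size_level lv).
Qed.

Lemma size_S_words n w : S_words f M n w -> size w = n.+1.
Proof. by rewrite S_wordsE => -[/size_level]. Qed.

(** At equal stages this is isolation. If [v] comes later, its prefix at the stage of [w] is a
    candidate that was not selected, so it differs from [w] and its image, which contains that of
    [v], misses the image of [w]. *)
Lemma Gamma_disjoint w v : Gamma f M w -> Gamma f M v -> w <> v ->
  (word_map f w @` M) `&` (word_map f v @` M) = set0.
Proof.
move=> [a _ Sw] [b _ Sv]; wlog : a b w v Sw Sv / (a <= b)%N => [hw wv|ab wv].
  have [ab|/ltnW ba] := leqP a b; first exact: hw Sw Sv ab wv.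
  by rewrite setIC; apply: hw Sv Sw ba _ => /esym.
move: (Sw) (Sv); rewrite !S_wordsE => -[lw iw] [lv _].
move: ab; rewrite leq_eqVlt => /orP[/eqP ab|ab].
  by apply: iw; [rewrite ab | apply/nesym].
have := take_level ab lv; rewrite T_wordsE => -[lv' nSv'].
rewrite -subset0 -(iw _ lv') => [|tE]; last by apply: nSv'; rewrite tE.
by apply: setIS; rewrite -{1}(cat_take_drop a.+1 v); exact: word_map_image_cat.
Qed.

Lemma level_prefix_word u n : level n (prefix_word u n.+1) \/
  exists2 k, (k < n)%N & S_words f M k (prefix_word u k.+1).
Proof.
elim: n => [|n [IH|[k kn Sk]]]; first by left; exists (u 0%N).
  have [Sn|nSn] := pselect (S_words f M n (prefix_word u n.+1)).
    by right; exists n.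
  left; exists (prefix_word u n.+1); first by rewrite T_wordsE.
  by exists (u n.+1); rewrite /prefix_word mkseqS.
by right; exists k => //; rewrite ltnS ltnW.
Qed.

(** Otherwise the prefix of [u] as long as [w] is a rival candidate, or a shorter prefix is already
    in [Gamma]. Either has an image disjoint from that of [w], yet the coded point lies in both. *)
Lemma Gamma_prefix_word w u : Gamma f M w ->
  (word_map f w @` M) (coding_map f u) -> prefix_word u (size w) = w.
Proof.
move=> Gw wu; have [n _ Sw] := Gw; rewrite (size_S_words Sw).
apply: contrapT => puw.
suff [k dis] : exists k, (word_map f w @` M) `&`
    (word_map f (prefix_word u k) @` M) = set0.
  have : set0 (coding_map f u) by rewrite -dis; split => //; exact: coding_map_mem.
  by [].
have [lu|[k kn Sk]] := level_prefix_word u n.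
  exists n.+1; move: Sw; rewrite S_wordsE => -[_]; exact.
exists k.+1; apply: Gamma_disjoint => //; first by exists k.
move=> wE; have := size_S_words Sw; rewrite wE size_prefix_word => -[kE].
by rewrite kE ltnn in kn.
Qed.

Lemma Gamma_size_gt0 w : Gamma f M w -> (0 < size w)%N.
Proof. by move=> [n _ /size_S_words ->]. Qed.

(** * Infinite concatenations of words *)

Definition concat (sigma : nat -> seq 'I_m) n := flatten (mkseq sigma n).

Lemma concatS sigma n : concat sigma n.+1 = concat sigma n ++ sigma n.
Proof. by rewrite /concat mkseqS flatten_rcons. Qed.

Lemma leq_size_concat sigma n : (forall k, (0 < size (sigma k))%N) ->
  (n <= size (concat sigma n))%N.
Proof.
move=> s0; elim: n => // n IH.
by rewrite concatS size_cat -addn1 leq_add.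
Qed.

(** Says that [u] is the infinite concatenation of the words [sigma k]; as a relation it needs no
    default letter. *)
Definition follows (sigma : nat -> seq 'I_m) u :=
  forall n, prefix_word u (size (concat sigma n)) = concat sigma n.

Lemma follows_inj sigma (u v : nat -> 'I_m) : (forall k, (0 < size (sigma k))%N) ->
  follows sigma u -> follows sigma v -> u = v.
Proof.
move=> s0 su sv; apply/funext => n.
have ns := leq_size_concat n.+1 s0.
rewrite -(nth_mkseq (u n) u ns) -(nth_mkseq (u n) v ns).
by have := su n.+1; have := sv n.+1; rewrite /prefix_word => -> ->.
Qed.

Lemma follows_exists sigma : (forall k, (0 < size (sigma k))%N) ->
  exists u, follows sigma u.
Proof.
move=> s0; have [i0] : exists i0 : 'I_m, true.
  by have := s0 0%N; case: (sigma 0%N) => // i; exists i.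
have catE k n : (k <= n)%N -> exists z, concat sigma n = concat sigma k ++ z.
  move=> kn; rewrite -(subnKC kn); elim: (n - k)%N => [|j [z zE]].
    by exists [::]; rewrite addn0 cats0.
  by exists (z ++ sigma (k + j)%N); rewrite addnS concatS zE catA.
have nthE k n i : (k <= n)%N -> (i < size (concat sigma k))%N ->
    nth i0 (concat sigma n) i = nth i0 (concat sigma k) i.
  by move=> kn ik; have [z ->] := catE _ _ kn; rewrite nth_cat ik.
(* The letter of index [k] is read in [concat sigma k.+1], long enough because no word is empty; the
   default [i0] is never reached. *)
exists (fun k => nth i0 (concat sigma k.+1) k) => n.
apply: (@eq_from_nth _ i0); rewrite size_prefix_word// => i ilt.
rewrite nth_mkseq//; have [/ltnW ni|ni] := ltnP n i.+1.
  by rewrite (nthE n).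
by rewrite -(nthE _ n)// leq_size_concat.
Qed.

Lemma follows_shift_mem sigma u n : follows sigma u ->
  (word_map f (sigma n) @` M) (coding_map f (shift u (size (concat sigma n)))).
Proof.
move=> su.
suff <- : prefix_word (shift u (size (concat sigma n))) (size (sigma n)) = sigma n.
  exact: coding_map_mem.
have := su n.+1; rewrite concatS size_cat prefix_wordD su => /eqP.
by rewrite eqseq_cat// eqxx => /eqP.
Qed.

Lemma follows_coding_map_shift sigma u n : follows sigma u ->
  coding_map f u =
  word_map f (concat sigma n) (coding_map f (shift u (size (concat sigma n)))).
Proof. by move=> su; rewrite {1}(coding_map_shift u (size (concat sigma n))) su. Qed.

(** By induction [v] begins with [concat sigma n]. Injectivity strips this word, and the remaining
    sequence codes a point in the image of [sigma n], so it must begin with [sigma n]. *)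
Lemma follows_coding_map sigma (u v : nat -> 'I_m) :
  (forall k, Gamma f M (sigma k)) ->
  follows sigma u -> coding_map f v = coding_map f u -> v = u.
Proof.
move=> Gs su vu; have s0 k : (0 < size (sigma k))%N by exact: Gamma_size_gt0.
apply: (follows_inj s0 _ su); elim=> [//|n IH].
rewrite concatS size_cat prefix_wordD IH; congr cat.
apply: Gamma_prefix_word => //.
move: vu; rewrite (coding_map_shift v (size (concat sigma n))) IH.
rewrite (follows_coding_map_shift n su) => /word_map_inj ->.
exact: follows_shift_mem.
Qed.

(** The word [w] followed by [u]: beyond the end of [w], [nth] returns its default, which is the
    wanted letter of [u]. *)
Definition word_cat w u : nat -> 'I_m := fun n => nth (u (n - size w)%N) w n.

Lemma prefix_word_cat w u : prefix_word (word_cat w u) (size w) = w.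
Proof.
apply: (@eq_from_nth _ (u 0%N)); rewrite size_prefix_word// => i iw.
by rewrite nth_mkseq// /word_cat; exact: set_nth_default.
Qed.

Lemma shift_word_cat w u : shift (word_cat w u) (size w) = u.
Proof.
apply/funext => n; rewrite /shift /word_cat nth_default ?leq_addr//.
by rewrite addKn.
Qed.

Lemma shift0 u : shift u 0 = u.
Proof. by apply/funext => n. Qed.

Lemma shiftD u k n : shift (shift u k) n = shift u (k + n).
Proof. by apply/funext => j; rewrite /shift addnA. Qed.

(** Putting the first [k] letters of [u] before a second coding of the shifted point would give a
    second coding of the original one. *)
Lemma univoque_shift K u k : (forall v : nat -> 'I_m, K (coding_map f v)) ->
  univoque_set f K (coding_map f u) ->
  univoque_set f K (coding_map f (shift u k)).
Proof.
move=> hK [_ [u' [_ u'u]]]; split => //; exists (shift u k); split => // v vE.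
have <- : u' = u by exact: u'u.
rewrite (u'u (word_cat (prefix_word u k) v)).
  by rewrite -{2}(size_prefix_word u k) shift_word_cat.
rewrite (coding_map_shift _ (size (prefix_word u k))) shift_word_cat.
by rewrite prefix_word_cat vE -coding_map_shift.
Qed.

Definition eventually_V u := exists ws : seq (seq 'I_m),
  [/\ {in ws, forall w, Gamma f M w},
      prefix_word u (size (flatten ws)) = flatten ws &
      V_set f M (shift u (size (flatten ws)))].

(** The case [ws = [::]] shows that [u] begins with a word of [Gamma]. Were the rest [eventually_V],
    prepending that word to its list would make [u] so. *)
Lemma not_eventually_V u : ~ eventually_V u ->
  exists w, [/\ Gamma f M w, prefix_word u (size w) = w &
                ~ eventually_V (shift u (size w))].
Proof.
move=> nVu; have /contrapT[k _ Gk] : ~ V_set f M u.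
  by move=> Vu; apply: nVu; exists [::]; split => //=; rewrite shift0.
exists (prefix_word u k); rewrite size_prefix_word; split => // -[ws [Gws wsE V]].
apply: nVu; exists (prefix_word u k :: ws); split => /=.
- by move=> w; rewrite inE => /predU1P[->//|]; exact: Gws.
- by rewrite size_cat size_prefix_word prefix_wordD wsE.
- by rewrite size_cat size_prefix_word -shiftD.
Qed.

(** * Upper bound *)

Lemma word_ratio_powR_gap (s t : R) : (s < t)%R ->
  exists2 q : R, 0 < q < 1 & forall w, Gamma f M w ->
    word_ratio r w `^ t <= q * word_ratio r w `^ s.
Proof.
move=> st; have [rho /andP[rho0 rho1] rrho] := ratio_bound.
have ts0 : 0 < t - s by rewrite subr_gt0.
exists (rho `^ (t - s)).
  rewrite powR_gt0//=; have := @gt0_ltr_powR R (t - s) ts0 rho 1; rewrite powR1.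
  by apply; rewrite // nnegrE ltW.
move=> w Gw; have w0 := word_ratio_gt0 w.
have -> : word_ratio r w `^ t = word_ratio r w `^ (t - s) * word_ratio r w `^ s.
  by rewrite -powRD ?subrK// (gt_eqF w0) implybT.
rewrite ler_wpM2r ?powR_ge0//.
apply: ge0_ler_powR; rewrite ?nnegrE ?(ltW ts0) ?(ltW w0) ?(ltW rho0)//.
apply: le_trans (word_ratio_le w rrho) _.
by rewrite -[leRHS]expr1 ler_wiXn2l ?(ltW rho0) ?(ltW rho1)//; exact: Gamma_size_gt0.
Qed.

Lemma hausdorff_measure_eq0_self_covered (t q : R) (X : set 'cV[R]_d) :
  (0 <= t)%R -> (0 <= q)%R -> (q < 1)%R ->
  (\esum_(w in Gamma f M) (word_ratio r w `^ t)%:E <= q%:E)%E ->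
  X `<=` M -> X `<=` \bigcup_(w in Gamma f M) (word_map f w @` X) ->
  hausdorff_measure t X = 0%E.
Proof.
move=> t0 q0 q1 sumq XM XX.
have [rho /andP[rho0 rho1] rrho] := ratio_bound.
have [B B0 hB] := compact_enorm_bounded hMc.
have dM : (Defs.diam M <= B%:E)%E.
  by apply: ge_ereal_sup => _ [x [y [Mx My ->]]]; rewrite lee_fin hB.
(* The scale [delta] varies in the induction, since passing to the copy of [w] replaces it by
   [delta / word_ratio r w]. *)
have key n delta : 0 < delta -> B * rho ^+ n <= delta ->
    (hausdorff_premeasure t delta X <= (q ^+ n * B `^ t)%:E)%E.
  elim: n delta => [|n IH] delta d0 nd.
    apply: le_trans (hausdorff_premeasure_cover t XM _) _.
      by apply: le_trans dM _; rewrite lee_fin; rewrite expr0 mulr1 in nd.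
    rewrite diam_powE// expr0 mul1r -poweR_EFin.
    by apply: (gt0_ler_poweR t0 _ _ dM);
      rewrite in_itv/= leey andbT ?diam_ge0// lee_fin ltW.
  apply: le_trans (hausdorff_premeasure_sub t delta XX) _.
  apply: le_trans (hausdorff_premeasure_bigcup _ _ _ _) _.
  apply: (@le_trans _ _ (\esum_(w in Gamma f M)
      ((q ^+ n * B `^ t)%:E * (word_ratio r w `^ t)%:E))%E).
    apply: le_esum => w Gw; have w0 := word_ratio_gt0 w.
    apply: le_trans (hausdorff_premeasure_similarity _ _ w0 t0
      (enorm_word_map w)) _.
    rewrite muleC; apply: lee_wpmul2r; first by rewrite lee_fin powR_ge0.
    apply: IH; first by rewrite divr_gt0.
    rewrite ler_pdivlMr//; apply: le_trans nd; rewrite exprSr mulrA.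
    rewrite ler_wpM2l ?mulr_ge0 ?exprn_ge0 ?(ltW B0) ?(ltW rho0)//.
    rewrite -[leRHS]expr1; apply: le_trans (word_ratio_le w rrho) _.
    by rewrite ler_wiXn2l ?(ltW rho0) ?(ltW rho1)//; exact: Gamma_size_gt0.
  apply: le_trans (esumZl_le _ _ _) _.
  - by rewrite lee_fin mulr_ge0 ?exprn_ge0 ?powR_ge0.
  - by move=> w; rewrite lee_fin powR_ge0.
  apply: (@le_trans _ _ ((q ^+ n * B `^ t)%:E * q%:E)%E).
    by apply: lee_wpmul2l => //; rewrite lee_fin mulr_ge0 ?exprn_ge0 ?powR_ge0.
  by rewrite -EFinM lee_fin mulrAC -exprSr.
apply/hausdorff_measure_eq0 => delta d0; apply/eqP.
rewrite eq_le hausdorff_premeasure_ge0 andbT; apply/lee_addgt0Pr => e e0.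
have [N1 hN1] := geometric_small B (ltW rho0) rho1 d0.
have [N2 hN2] := geometric_small (B `^ t) q0 q1 e0.
apply: le_trans (key (maxn N1 N2) delta d0 _) _.
  by apply/ltW/hN1; rewrite leq_maxl.
by rewrite add0e lee_fin mulrC; apply/ltW/hN2; rewrite leq_maxr.
Qed.

(* A univoque point has a coding that is either a finite concatenation of words
   of Gamma followed by an element of V, or belongs to a set of codings that is
   stable under removing a first word of Gamma. *)
Lemma univoque_measure_eq0 (K : set 'cV[R]_d) (s t : R) :
  (forall u : nat -> 'I_m, K (coding_map f u)) ->
  (0 <= t)%R -> (s < t)%R ->
  (\esum_(w in Gamma f M) (word_ratio r w `^ s)%:E = 1)%E ->
  hausdorff_measure t (coding_map f @`
    (V_set f M `&` coding_map f @^-1` univoque_set f K)) = 0%E ->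
  hausdorff_measure t (univoque_set f K) = 0%E.
Proof.
move=> hK t0 st sum1; set W := coding_map f @` _ => HW.
pose X := [set coding_map f u | u in [set u | ~ eventually_V u]].
(* A countable cover of the univoque set: a similar copy of [W] for each list of words, and the
   remainder [X] at [None]. *)
pose A (o : option (seq (seq 'I_m))) :=
  if o is Some ws then word_map f (flatten ws) @` W else X.
apply: (@hausdorff_measure_eq0_sub _ _ _ _ (\bigcup_(o in setT) A o)).
  move=> x Ux; have [_ [u [uE _]]] := Ux.
  have [[ws [_ wsE Vws]]|nu] := pselect (eventually_V u); last first.
    by exists None => //; exists u.
  exists (Some ws) => //=; exists (coding_map f (shift u (size (flatten ws)))).
    exists (shift u (size (flatten ws))) => //; split => //=.
    by apply: univoque_shift => //; rewrite uE.
  by rewrite -uE (coding_map_shift u (size (flatten ws))) wsE.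
apply: hausdorff_measure_eq0_bigcup => -[ws|] _ /=.
  exact: hausdorff_measure_eq0_similarity (word_ratio_gt0 _) t0
    (enorm_word_map _) HW.
have [q /andP[q0 q1] hq] := word_ratio_powR_gap st.
apply: (@hausdorff_measure_eq0_self_covered t q) => //; first exact: ltW.
- rewrite -[leRHS]mule1 -sum1; apply: le_trans _ (esumZl_le _ _ _).
  + by apply: le_esum => w Gw; rewrite -EFinM lee_fin hq.
  + by rewrite lee_fin ltW.
  + by move=> w; rewrite lee_fin powR_ge0.
- by move=> _ [u _ <-]; have [y My <-] := coding_map_mem u 0.
- move=> _ [u nu <-]; have [w [Gw wE nw]] := not_eventually_V nu.
  exists w => //; exists (coding_map f (shift u (size w))).
    by exists (shift u (size w)).
  by rewrite (coding_map_shift u (size w)) wE.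
Qed.

(** * Lower bound *)

(** For negative [s] every term would exceed 1, and a sum equal to 1 has at least one term. *)
Lemma Gamma_sum_ge0 (s : R) :
  (\esum_(w in Gamma f M) (word_ratio r w `^ s)%:E = 1)%E -> 0 <= s.
Proof.
move=> sum1; rewrite leNgt; apply/negP => s0.
have [q /andP[q0 q1] hq] := word_ratio_powR_gap s0.
have [G0|/set0P[w Gw]] := eqVneq (Gamma f M) set0.
  by move/eqP: sum1; rewrite G0 esum_set0 eq_sym onee_eq0.
have : ((word_ratio r w `^ s)%:E <= 1)%E.
  by rewrite -sum1; apply: (esum_ge_term Gw); rewrite lee_fin powR_ge0.
rewrite lee_fin => ws1; have := hq _ Gw; rewrite powRr0 leNgt => /negP; apply.
by apply: le_lt_trans q1; rewrite ler_piMr// ltW.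
Qed.

(** Some finite part of the sum at [s] exceeds [q < 1]; lowering the exponent to [t] gains the
    factor [1 / q]. The full sum at [t] may be infinite. *)
Lemma Gamma_finite_subfamily (s t : R) : (t < s)%R ->
  (\esum_(w in Gamma f M) (word_ratio r w `^ s)%:E = 1)%E ->
  exists (A : finType) (w : A -> seq 'I_m), [/\ injective w,
    forall a, Gamma f M (w a) & 1 < \sum_a word_ratio r (w a) `^ t].
Proof.
move=> ts sum1; have [q /andP[q0 q1] hq] := word_ratio_powR_gap ts.
have : (q%:E < \esum_(w in Gamma f M) (word_ratio r w `^ s)%:E)%E.
  by rewrite sum1 lte_fin.
move=> /ereal_sup_gt[_ [X [finX XG] <-]]; rewrite fsbig_finite// sumEFin lte_fin.
rewrite (big_nth [::]) big_mkord; set l : seq _ := finmap.enum_fset _ => ql.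
have lG (a : 'I_(size l)) : Gamma f M (nth [::] l a).
  by apply: XG; have := mem_nth [::] (ltn_ord a); rewrite in_fset_set// inE.
exists 'I_(size l), (fun a : 'I_(size l) => nth [::] l a); split => //.
  move=> a b /eqP; rewrite nth_uniq//; first by move/eqP/val_inj.
  exact: finmap.fset_uniq.
rewrite -(@ltr_pM2l _ q)// mulr1; apply: lt_le_trans ql _.
by rewrite mulr_sumr; apply: ler_sum => a _; exact: hq.
Qed.

(** * Mass distribution on the limit set of a finite subfamily of Gamma *)

Section finite_subfamily.
Context {A : finType} {w : A -> seq 'I_m}.
Hypothesis w_inj : injective w.
Hypothesis Gw : forall a, Gamma f M (w a).

(** Finiteness of the subfamily enters here: the least of finitely many positive gaps is
    positive. *)
Lemma subfamily_gap : exists2 c : R, 0 < c & forall a b x y, a != b ->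
  (word_map f (w a) @` M) x -> (word_map f (w b) @` M) y ->
  c <= enorm (x - y).
Proof.
have /choice[c cP] (ab : A * A) : exists c : R, 0 < c /\
    (ab.1 != ab.2 -> forall x y, (word_map f (w ab.1) @` M) x ->
      (word_map f (w ab.2) @` M) y -> c <= enorm (x - y)).
  have [_|ab_neq] := eqVneq ab.1 ab.2; first by exists 1.
  have [| | |c c0 hc] := @disjoint_compact_gap _ _ (word_map f (w ab.1) @` M)
    (word_map f (w ab.2) @` M).
  - exact: compact_word_map.
  - exact: compact_word_map.
  - by apply: Gamma_disjoint => // /w_inj/eqP; apply/negP.
  - by exists c.
exists (\big[Num.min/1]_ab c ab).
  by apply: lt_bigmin => // ab _; have [] := cP ab.
move=> a b x y ab ax yb; apply: le_trans (bigmin_le _ (a, b) _) _.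
by have [_ /(_ ab)] := cP (a, b); apply.
Qed.

Context {t : R}.
Let P := \sum_a word_ratio r (w a) `^ t.
Hypothesis t0 : 0 <= t.
Hypothesis P1 : 1 < P.
(** The Bernoulli mass of the cylinder of [v]; dividing by [P] makes the letter probabilities sum to
    1. *)
Let weight (v : seq A) := \prod_(a <- v) (word_ratio r (w a) `^ t / P).

Let P0 : 0 < P. Proof. exact: lt_trans P1. Qed.

Lemma weight_le_ratio (v : seq A) : weight v <= word_ratio r (flatten (map w v)) `^ t.
Proof.
elim: v => [|a v IH]; first by rewrite /weight /word_ratio !big_nil powR1.
rewrite /weight big_cons /= word_ratio_cat powRM ?(ltW (word_ratio_gt0 _))//.
apply: ler_pM => //.
- by rewrite divr_ge0 ?powR_ge0// ltW.
- by apply: prodr_ge0 => b _; rewrite divr_ge0 ?powR_ge0// ltW.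
- by rewrite ler_pdivrMr// ler_peMr ?powR_ge0// ltW.
Qed.

(** Ratios are at most 1, so a letter has mass at most [P^-1 < 1]. Deep cylinders are thus
    negligible. *)
Lemma weight_le_geometric (v : seq A) : weight v <= P^-1 ^+ size v.
Proof.
elim: v => [|a v IH]; first by rewrite /weight big_nil.
rewrite /weight big_cons /= exprS; apply: ler_pM => //.
- by rewrite divr_ge0 ?powR_ge0// ltW.
- by apply: prodr_ge0 => b _; rewrite divr_ge0 ?powR_ge0// ltW.
- rewrite ler_piMl ?invr_ge0 ?(ltW P0)//.
  have [rho /andP[rho0 rho1] rrho] := ratio_bound.
  rewrite [leRHS](_ : _ = 1 `^ t); last by rewrite powR1.
  apply: ge0_ler_powR => //.
  + by rewrite nnegrE ltW// word_ratio_gt0.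
  + by rewrite nnegrE.
  + by apply: le_trans (word_ratio_le _ rrho) _; rewrite exprn_ile1// ltW.
Qed.

Lemma concat_comp (sigma : nat -> A) n :
  concat (w \o sigma) n = flatten (map w (mkseq sigma n)).
Proof. by rewrite /concat /mkseq map_comp. Qed.

(** The cylinder is the longest common prefix of the sequences hitting [C]: the gap after it bounds
    the diameter of [C] from below. If at most one sequence hits [C], a cylinder of depth [N] has
    mass below [eps]. *)
Lemma cover_set_cylinder (c : R) (C : set 'cV[R]_d) (eps : R) :
  0 < c ->
  (forall a b x y, a != b -> (word_map f (w a) @` M) x ->
    (word_map f (w b) @` M) y -> c <= enorm (x - y)) ->
  0 < eps ->
  exists v : seq A,
    (forall sigma u, follows (w \o sigma) u -> C (coding_map f u) ->
      mkseq sigma (size v) = v) /\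
    ((weight v)%:E <= ((c `^ t)^-1)%:E * diam_pow t C + eps%:E)%E.
Proof.
move=> c0 gap eps0.
have [N hN] : exists N, forall n, (N <= n)%N -> 1 * P^-1 ^+ n < eps.
  by apply: geometric_small; rewrite ?invr_ge0 ?(ltW P0) ?invf_lt1.
have small (v : seq A) : size v = N ->
    ((weight v)%:E <= ((c `^ t)^-1)%:E * diam_pow t C + eps%:E)%E.
  move=> sv; rewrite -[leLHS]add0e; apply: leeD.
    by rewrite mule_ge0 ?diam_pow_ge0// lee_fin invr_ge0 powR_ge0.
  rewrite lee_fin; apply: le_trans (weight_le_geometric v) _.
  by rewrite -[leLHS]mul1r ltW// hN// sv.
pose hits sigma := exists2 u, follows (w \o sigma) u & C (coding_map f u).
have [[sigma [u su Cu]]|nohit] := pselect (exists sigma, hits sigma); last first.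
  (* [A] is inhabited, an empty sum being 0. Nothing hits [C], so any cylinder of depth [N]
     works. *)
  have [a _] : exists a : A, true.
    apply: contrapT => /forallNP noA; move: P1.
    by rewrite /P big1 ?ltr10// => a; have := noA a.
  exists (nseq N a); split; last by rewrite small// size_nseq.
  by move=> tau v tv Cv; exfalso; apply: nohit; exists tau; exists v.
pose splits k := `[< exists2 tau, hits tau & mkseq tau k <> mkseq sigma k >].
have [exk|nok] := pselect (exists k, splits k); last first.
  exists (mkseq sigma N); split; last by rewrite small// size_mkseq.
  move=> tau v tv Cv; rewrite size_mkseq; apply: contrapT => ne.
  by apply: nok; exists N; apply/asboolP; exists tau => //; exists v.
(* Length 0 never splits, so the least splitting length is [k.+1]: all hitting sequences agree with
   [sigma] on [k] letters, and [tau] differs from it at index [k]. *)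
case: (ex_minnP exk) => -[|k] /asboolP[tau [u' tu' Cu'] ne] kmin.
  by exfalso; apply: ne.
have agree tau' : hits tau' -> mkseq tau' k = mkseq sigma k.
  move=> ht; apply: contrapT => nek.
  have /kmin : splits k by apply/asboolP; exists tau'.
  by rewrite ltnn.
exists (mkseq sigma k); split.
  by move=> tau' v tv Cv; rewrite size_mkseq; apply: agree; exists v.
have tauk : mkseq tau k = mkseq sigma k by apply: agree; exists u'.
have {}ne : sigma k != tau k.
  by apply: contra_not_neq ne => st; rewrite !mkseqS tauk st.
rewrite -[leLHS]adde0; apply: leeD; last by rewrite lee_fin ltW.
apply: (@le_trans _ _ (word_ratio r (concat (w \o sigma) k) `^ t)%:E).
  by rewrite lee_fin concat_comp weight_le_ratio.
have ct0 : 0 < c `^ t by rewrite powR_gt0.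
rewrite lee_pdivlMl// diam_powE; last by exists (coding_map f u).
have r0 := word_ratio_gt0 (concat (w \o sigma) k).
rewrite -EFinM -powRM ?(ltW c0) ?(ltW r0)// -poweR_EFin.
(* Behind the common word the two points lie in images of different words, at least [c] apart; the
   common word scales this gap by its ratio. *)
have cr : ((c * word_ratio r (concat (w \o sigma) k))%:E <= Defs.diam C)%E.
  apply: le_trans (diam_ge Cu Cu'); rewrite lee_fin.
  rewrite (follows_coding_map_shift k su) (follows_coding_map_shift k tu').
  have -> : concat (w \o tau) k = concat (w \o sigma) k.
    by rewrite !concat_comp tauk.
  rewrite enorm_word_map mulrC ler_wpM2l ?(ltW r0)//.
  apply: gap ne _ _; first exact: (follows_shift_mem k su).
  have := follows_shift_mem k tu'; rewrite !concat_comp tauk; exact.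
apply: (gt0_ler_poweR t0 _ _ cr); rewrite in_itv/= leey andbT.
  by rewrite lee_fin mulr_ge0 ?(ltW c0) ?(ltW r0).
by apply: le_trans cr; rewrite lee_fin mulr_ge0 ?(ltW c0) ?(ltW r0).
Qed.

(** A cheap cover of the univoque set would give cylinders of total mass below 1. A sequence
    avoiding them all codes a univoque point that no covering set can contain. *)
Lemma univoque_measure_neq0 (K : set 'cV[R]_d) :
  (forall u : nat -> 'I_m, K (coding_map f u)) ->
  hausdorff_measure t (univoque_set f K) <> 0%E.
Proof.
move=> hK /hausdorff_measure_eq0 /(_ 1 ltr01) HU.
have [c c0 gap] := subfamily_gap.
have ct0 : 0 < c `^ t by rewrite powR_gt0.
(* With this bound the cylinders have total mass at most 1/4, plus 1/2 from the errors [eps n]. *)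
have : (hausdorff_premeasure t 1 (univoque_set f K) < (c `^ t / 4%:R)%:E)%E.
  by rewrite HU lte_fin divr_gt0.
move=> /ereal_inf_lt[_ [C [UC _] ->] Csum].
pose eps n : R := 2^-1 / (2 ^ n.+1)%:R.
have eps0 n : 0 < eps n by rewrite divr_gt0 ?invr_gt0 ?ltr0n ?expn_gt0.
have /choice[v vP] n := cover_set_cylinder (C n) c0 gap (eps0 n).
have weight0 a : 0 <= word_ratio r (w a) `^ t / P.
  by rewrite divr_ge0 ?powR_ge0// ltW.
have [|/=|sigma hsigma] := @exists_avoiding_sequence R A _ v weight0.
- by rewrite -mulr_suml divff// gt_eqF.
- apply: (@le_lt_trans _ _ (\sum_(0 <= n <oo)
      (((c `^ t)^-1)%:E * diam_pow t (C n) + (eps n)%:E))%E).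
    apply: lee_nneseries => [n _ _|n _]; first by rewrite lee_fin prodr_ge0.
    by have [] := vP n.
  rewrite nneseriesD => [|n _|n _]; last 2 first.
    by rewrite mule_ge0 ?diam_pow_ge0// lee_fin invr_ge0 powR_ge0.
    by rewrite lee_fin ltW.
  rewrite nneseriesZl => [|n _]; last exact: diam_pow_ge0.
  apply: (@le_lt_trans _ _ ((4%:R^-1)%:E + (2^-1)%:E)%E).
    apply: leeD; last by rewrite (epsilon_trick0 xpredT)// invr_ge0.
    by rewrite lee_pdivrMl// -EFinM ltW.
  by rewrite -EFinD lte_fin; lra.
have Gs k : Gamma f M ((w \o sigma) k) by exact: Gw.
have [u su] := follows_exists (fun k => Gamma_size_gt0 (Gs k)).
have : univoque_set f K (coding_map f u).
  split => //; exists u; split => // u' u'E.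
  by rewrite (follows_coding_map Gs su u'E).
move=> /UC[n _ Cn]; have [vn _] := vP n.
by apply: (hsigma n); exact: vn su Cn.
Qed.

End finite_subfamily.

End coding.

Theorem corollary1p2 (R : realType) (d m : nat) (hd : (1 <= d)%N) (hm : (1 <= m)%N)
    (r : 'I_m -> R) (Q : 'I_m -> 'M[R]_d) (b : 'I_m -> 'cV[R]_d)
    (hr : forall i, 0 < r i < 1) (hQ : forall i, orthogonal_mx (Q i))
    (f : 'I_m -> 'cV[R]_d -> 'cV[R]_d)
    (hf : forall i, f i = similitude (r i) (Q i) (b i))
    (K : set 'cV[R]_d) (hK : self_similar_set f K)
    (M : set 'cV[R]_d) (hM0 : M !=set0) (hMc : compact M)
    (hMf : forall i, f i @` M `<=` M)
    (s : R)
    (hs : (\esum_(w in Gamma f M) (word_ratio r w `^ s)%:E = 1)%E) :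
  let U := univoque_set f K in
  let W := V_set f M `&` coding_map f @^-1` U in
  (s%:E <= hausdorff_dim U)%E /\
  (hausdorff_dim U = s%:E <->
   (hausdorff_dim (coding_map f @` W) <= s%:E)%E).
Proof.
move=> U W.
have hsim i x y : enorm (f i x - f i y) = r i * enorm (x - y).
  by rewrite hf enorm_similitude//; have /andP[/ltW] := hr i.
have [K0 Kc KE] := hK.
have Kf i : f i @` K `<=` K by move=> x fx; rewrite KE; exists i.
(* [K] is itself compact and invariant, so [coding_map_mem] applies with [K] in place of [M]. *)
have hKc u : K (coding_map f u).
  by have [x Kx <-] := coding_map_mem hr hsim K0 Kc Kf u 0.
have s_ge0 := Gamma_sum_ge0 hr hs.
have sU : (s%:E <= hausdorff_dim U)%E.
  apply: hausdorff_dim_ge => t t0 ts.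
  have [A [w [w_inj Gw P1]]] := Gamma_finite_subfamily hr ts hs.
  exact: (univoque_measure_neq0 hr hsim hM0 hMc hMf w_inj Gw t0 P1).
split => //; split => [<-|dimW].
  by apply: hausdorff_dim_sub => _ [u [_ Uu] <-].
(* For every [t > s] the image of [W] is null in dimension [t], which forces the univoque set to be
   null as well. *)
apply/eqP; rewrite eq_le sU andbT; apply: hausdorff_dim_le => // t st.
have t0 : 0 <= t by rewrite (le_trans s_ge0)// ltW.
apply: (univoque_measure_eq0 hr hsim hM0 hMc hMf hKc t0 st hs).
by apply: hausdorff_dim_lt; apply: le_lt_trans dimW _; rewrite lte_fin.
Qed.
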